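(* Suppose that $r$ is a proper tensor rank function, and $\bar r$ is its closure. Then $\bar r$ has the max-full-rank-subtensor property.
   Context: $\mathbf{Z}_+$ is the set of nonnegative integers and $\mathbf{N}$ the set of positive integers. For $m,n_1,\dots,n_m\in\mathbf{N}$, $\mathbf{T}(n_1,\dots,n_m)$ is the set of real $m$th order tensors $\mathcal{X}=(x_{i_1\cdots i_m})$ of dimension $n_1\times\cdots\times n_m$; $\mathbf{CT}(m,n)$ is the case $n_1=\cdots=n_m=n$; $\mathbf{T}$ is the set of all real tensors (all orders $m\ge1$, all dimensions). A tensor $\mathcal{X}\in\mathbf{T}(n_1,\dots,n_m)$ is rank-one if $\mathcal{X}=\mathbf{x}^{(1)}\circ\cdots\circ\mathbf{x}^{(m)}$ (outer product) with nonzero $\mathbf{x}^{(i)}\in\mathbb{R}^{n_i}$. The identity tensor $\mathcal{I}_{m,n}\in\mathbf{CT}(m,n)$ has entries $1$ when $i_1=\cdots=i_m$ and $0$ otherwise. A subtensor of $\mathcal{X}\in\mathbf{T}(n_1,\dots,n_m)$ is a tensor of the same order $m$ obtained by choosing nonempty index sets $T_l\subseteq\{1,\dots,n_l\}$, $l=1,\dots,m$, and restricting $\mathcal{X}$ to $T_1\times\cdots\times T_m$; it is an element of $\mathbf{T}(|T_1|,\dots,|T_m|)$. A function $r:\mathbf{T}\to\mathbf{Z}_+$ is a tensor rank function if: (1) $r(\mathcal{X})=0$ iff $\mathcal{X}$ is a zero tensor, and $r(\mathcal{X})=1$ iff $\mathcal{X}$ is a rank-one tensor; (2) $r(\mathcal{I}_{m,n})=n$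 for all $m,n\in\mathbf{N}$ with $m\ge2$; (3) for $\mathcal{X}\in\mathbf{T}(n_1,n_2,1,\dots,1)$ (order at least $2$), $r(\mathcal{X})$ equals the matrix rank of the $n_1\times n_2$ matrix corresponding to $\mathcal{X}$; (4) $r(\alpha\mathcal{X})=r(\mathcal{X})$ for every tensor $\mathcal{X}$ and real $\alpha\ne0$; (5) $r(\mathcal{Y})=r(\mathcal{X})$ whenever $\mathcal{Y}$ is obtained from $\mathcal{X}$ by permuting its modes, i.e. $\sigma$ is a permutation of the $m$ coordinates, $\mathcal{Y}$ has dimensions $\sigma(n_1,\dots,n_m)$, and the entry of $\mathcal{Y}$ at position $\sigma(i_1,\dots,i_m)$ is $x_{i_1\cdots i_m}$; (6) $r(\mathcal{Y})\le r(\mathcal{X})$ whenever $\mathcal{Y}$ is a subtensor of $\mathcal{X}$. A tensor rank function $r$ is proper if $r(\mathcal{X})\le n$ for all $m,n\in\mathbf{N}$ and $\mathcal{X}\in\mathbf{CT}(m,n)$. Full rank: for a tensor rank function $r$, a tensor $\mathcal{X}\in\mathbf{T}(n_1,\dots,n_m)$ is of full $r$ rank if $r(\mathcal{X})=n_p$ for some index $p$ with $1\le p\le m$; in addition, zero tensors are regarded as being of full $r$ rank. A subtensor $\mathcal{Y}$ of $\mathcal{X}$ is a maximum full rank subtensor of $\mathcal{X}$ under $r$ if $\mathcal{Y}$ is of full $r$ rank and $r(\mathcal{Y})$ is the maximum of $r$ over all subtensors of $\mathcal{X}$ that are of full $r$ rank. The function $r$ has the max-full-rank-subtensor property if for every $\mathcal{X}\in\mathbf{T}$,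 $r(\mathcal{X})=r(\mathcal{Y})$ where $\mathcal{Y}$ is a maximum full rank subtensor of $\mathcal{X}$ under $r$. The closure $\bar r:\mathbf{T}\to\mathbf{Z}_+$ of a proper tensor rank function $r$ is defined by $\bar r(\mathcal{X})=\max\{r(\mathcal{Y}):\mathcal{Y}\text{ is a subtensor of }\mathcal{X}\text{ and is of full }r\text{ rank}\}$; it is itself a proper tensor rank function. *)

(* Defs.v *)
From HB Require Import structures.
From mathcomp Require Import all_boot all_order all_algebra perm.
From mathcomp Require Import reals.

Set Implicit Arguments.
Unset Strict Implicit.
Unset Printing Implicit Defensive.

Import Order.TTheory GRing.Theory Num.Theory.
Local Open Scope ring_scope.

Definition tindex (m : nat) (n : 'I_m -> nat) : finType :=
  {dffun forall l : 'I_m, 'I_(n l)}.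

(* The set T of all real tensors: every order m >= 1, every positive
   dimensions; modes and indices are numbered from 0. *)
Record tensor (R : realType) : Type := Tensor {
  torder : nat;
  tdim : 'I_torder -> nat;
  order_gt0 : (0 < torder)%N;
  dim_gt0 : forall l, (0 < tdim l)%N;
  tentry : {ffun tindex tdim -> R}
}.

Arguments Tensor {R torder tdim}.
Arguments tdim {R} _ _.

Section Tensors.
Variable R : realType.
Implicit Types (X Y Z : tensor R) (r : tensor R -> nat).

Definition zero_tensor X : bool := tentry X == 0.

Definition rank_one X : Prop :=
  exists v : forall l, 'cV[R]_(tdim X l),
    (forall l, v l != 0) /\
    (forall i : tindex (tdim X), tentry X i = \prod_l v l (i l) ord0).

(* CT(m, n), with m = torder X. *)
Definition cubical X (n : nat) : Prop := forall l, tdim X l = n.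

Definition identity_tensor (m n : nat) (hm : (0 < m)%N) (hn : (0 < n)%N) :
    tensor R :=
  Tensor hm (fun _ : 'I_m => hn)
    [ffun i : tindex (fun _ : 'I_m => n) =>
       [forall k : 'I_m, forall l : 'I_m, i k == i l]%:R].

Definition scale_tensor (a : R) X : tensor R :=
  Tensor (order_gt0 X) (@dim_gt0 R X) [ffun i => a * tentry X i].

Definition index_sets X : finType :=
  {dffun forall l : 'I_(torder X), {A : {set 'I_(tdim X l)} | A != set0}}.

Lemma index_sets_gt0 X (A : index_sets X) l : (0 < #|val (A l)|)%N.
Proof. by rewrite card_gt0 (valP (A l)). Qed.

(* enum_val lists the elements of a set of ordinals in increasing order. *)
Definition subtensor_of X (A : index_sets X) : tensor R :=
  Tensor (order_gt0 X) (index_sets_gt0 A)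
    [ffun i : tindex (fun l => #|val (A l)|) =>
       tentry X ([ffun l => enum_val (i l)] : tindex (tdim X))].

Definition subtensor Y X : Prop := exists A : index_sets X, Y = subtensor_of A.

(* In rank_matrix, M is the n_1 x n_2 matrix corresponding to X: an index of X
   is determined by its first two coordinates, the others ranging over 'I_1. *)
Record tensor_rank_function r : Prop := TensorRankFunction {
  rank_eq0 : forall X, r X = 0%N <-> zero_tensor X;
  rank_eq1 : forall X, r X = 1%N <-> rank_one X;
  rank_identity : forall m n (hm : (0 < m)%N) (hn : (0 < n)%N),
    (2 <= m)%N -> r (identity_tensor hm hn) = n;
  rank_matrix : forall m (n : 'I_m.+2 -> nat) (hn : forall l, (0 < n l)%N)
      (x : {ffun tindex n -> R}) (M : 'M[R]_(n ord0, n (lift ord0 ord0))),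
    (forall l : 'I_m.+2, (2 <= l)%N -> n l = 1%N) ->
    (forall i : tindex n, M (i ord0) (i (lift ord0 ord0)) = x i) ->
    r (Tensor (ltn0Sn m.+1) hn x) = \rank M;
  rank_scale : forall X (a : R), a != 0 -> r (scale_tensor a X) = r X;
  rank_perm : forall m (hm : (0 < m)%N) (n : 'I_m -> nat)
      (hn : forall l, (0 < n l)%N) (s : {perm 'I_m})
      (x : {ffun tindex n -> R}) (y : {ffun tindex (fun l => n (s l)) -> R}),
    (forall i : tindex n,
       y ([ffun l => i (s l)] : tindex (fun l => n (s l))) = x i) ->
    r (Tensor hm (fun l => hn (s l)) y) = r (Tensor hm hn x);
  rank_subtensor : forall X Y, subtensor Y X -> (r Y <= r X)%N
}.

Definition proper_rank r : Prop :=
  tensor_rank_function r /\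
  (forall (n : nat) X, cubical X n -> (r X <= n)%N).

Definition full_rank r X : bool :=
  zero_tensor X || [exists p, r X == tdim X p].

Definition max_full_rank_subtensor r Y X : Prop :=
  [/\ subtensor Y X, full_rank r Y &
      forall Z, subtensor Z X -> full_rank r Z -> (r Z <= r Y)%N].

(* All maximum full rank subtensors of X have the same r-value, so the choice
   of Y is immaterial. *)
Definition max_full_rank_subtensor_property r : Prop :=
  forall X, exists2 Y, max_full_rank_subtensor r Y X & r X = r Y.

(* Every subtensor of X is subtensor_of A for some A.  For a tensor rank function
   the range is nonempty, since 1 x ... x 1 subtensors are of full rank. *)
Definition rank_closure r X : nat :=
  \max_(A : index_sets X | full_rank r (subtensor_of A)) r (subtensor_of A).

End Tensors.

(* Main.v *)
Require Import Defs.
From mathcomp Require Import all_boot all_order all_algebra.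
From mathcomp Require Import boolp reals.

(** The closure is bounded above by [r], because [r] is monotone under
    subtensors, and agrees with [r] on tensors of full [r] rank.  Let [Y] be a
    full [r] rank subtensor of [X] attaining the maximum defining the closure at
    [X].  Then [Y] has the same rank under [r], under the closure, and as the
    closure of [X]; in particular [Y] is of full rank under the closure.
    Transitivity of the subtensor relation makes the closure monotone, so no
    other subtensor of [X] has larger closure. *)

Set Implicit Arguments.
Unset Strict Implicit.
Unset Printing Implicit Defensive.

Lemma sorted_enum_ord n (A : {set 'I_n}) :
  sorted (fun i j : 'I_n => i < j) (enum A).
Proof.
suff: sorted ltn (map (@nat_of_ord n) (enum A)) by rewrite sorted_map.
apply: (@subseq_sorted _ _ ltn_trans _ (iota 0 n)); last exact: iota_ltn_sorted.
by rewrite -val_enum_ord map_subseq // enumT /enum_mem filter_subseq.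
Qed.

Lemma enum_val_ltn n (A : {set 'I_n}) (i j : 'I_#|A|) :
  i < j -> enum_val i < enum_val j.
Proof.
move=> ltij; rewrite (enum_val_nth (enum_default i)).
rewrite (enum_val_nth (enum_default i) j).
apply: (sorted_ltn_nth _ _ (sorted_enum_ord A)) => //.
- by move=> y x z; apply: ltn_trans.
- by rewrite inE -cardE.
- by rewrite inE -cardE.
Qed.

(** Both lists are strictly sorted and have the same elements; for a transitive irreflexive relation
    this forces equality. *)
Lemma enum_imset_increasing m n (f : 'I_m -> 'I_n) :
    (forall i j : 'I_m, i < j -> f i < f j) ->
  enum (f @: [set: 'I_m]) = map f (enum 'I_m).
Proof.
move=> f_incr.
apply: (@irr_sorted_eq _ (fun i j : 'I_n => i < j)).
- by move=> y x z; apply: ltn_trans.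
- by move=> x; apply: ltnn.
- exact: sorted_enum_ord.
- rewrite sorted_map enumT -enum_setT.
  by apply: sub_sorted (sorted_enum_ord _) => i j; apply: f_incr.
move=> x; rewrite mem_enum; apply/imsetP/mapP => -[i _ ->];
  by exists i; rewrite ?mem_enum ?inE.
Qed.

Lemma enum_val_imset_increasing m n (f : 'I_m -> 'I_n)
    (i : 'I_#|f @: [set: 'I_m]|) (j : 'I_m) :
    (forall i j : 'I_m, i < j -> f i < f j) -> i = j :> nat ->
  enum_val i = f j.
Proof.
move=> f_incr eij; rewrite (enum_val_nth (f j)) enum_imset_increasing // eij.
by rewrite (nth_map j) ?size_enum_ord // nth_ord_enum.
Qed.

Section Subtensors.
Variable R : realType.
Implicit Types (X Y Z : tensor R) (r : tensor R -> nat).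

(** Pointwise equal dimensions still give different index types, so indices are matched through
    their values in [nat], which avoids casts. *)
Lemma eq_Tensor m (hm : 0 < m) (n n' : 'I_m -> nat)
    (hn : forall l, 0 < n l) (hn' : forall l, 0 < n' l)
    (x : {ffun tindex n -> R}) (x' : {ffun tindex n' -> R}) :
    n =1 n' ->
    (forall (i : tindex n) (i' : tindex n'),
       (forall l, i l = i' l :> nat) -> x i = x' i') ->
  Tensor hm hn x = Tensor hm hn' x'.
Proof.
move=> /funext en; case: n' / en hn' x' => hn' x' exx'.
rewrite (Prop_irrelevance hn' hn); congr Tensor.
by apply/ffunP => i; apply: exx'.
Qed.

(** The index sets are the images of the maps [f l], and [enum_val] on such an image recovers [f l].
    Increasing maps compose, which index sets do not do directly. *)
Lemma subtensor_increasing X (n : 'I_(torder X) -> nat)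
    (hn : forall l, 0 < n l) (f : forall l, 'I_(n l) -> 'I_(tdim X l)) :
    (forall l (i j : 'I_(n l)), i < j -> f l i < f l j) ->
  subtensor (Tensor (Defs.order_gt0 X) hn
    [ffun i : tindex n =>
       tentry X ([ffun l => f l (i l)] : tindex (tdim X))]) X.
Proof.
move=> f_incr.
have f_inj l : injective (f l).
  move=> i j eij; apply/val_inj; case: (ltngtP i j) => // /f_incr;
    by rewrite eij ltnn.
have cardf l : #|f l @: [set: 'I_(n l)]| = n l.
  by rewrite card_imset ?cardsT ?card_ord; last exact: f_inj.
have f_neq0 l : f l @: [set: 'I_(n l)] != set0 by rewrite -card_gt0 cardf.
exists ([ffun l => exist (fun A : {set _} => A != set0) _ (f_neq0 l)]
  : index_sets X).
apply: eq_Tensor => [l|i i' eii']; first by rewrite ffunE /= cardf.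
rewrite !ffunE; congr (tentry X _); apply/ffunP => l; rewrite !ffunE.
(* The type of [i' l] mentions the chosen index set, so [i' l] is generalized before that set is
   computed. *)
move: (i' l) (eii' l); rewrite ffunE /= => j eij.
by rewrite (enum_val_imset_increasing (f_incr l) (esym eij)).
Qed.

Lemma subtensor_refl X : subtensor X X.
Proof.
have := @subtensor_increasing X _ (@dim_gt0 _ X) (fun l i => i) (fun l i j => id).
congr subtensor; case: X => m n hm hn x /=; congr Tensor.
by apply/ffunP => i; rewrite ffunE; congr (x _); apply/ffunP => l; rewrite ffunE.
Qed.

Lemma subtensor_trans Y X Z : subtensor Z Y -> subtensor Y X -> subtensor Z X.
Proof.
move=> [B ->] [A eY]; move: B; rewrite eY => B.
(* The inner [enum_val] lists [B l] inside the index range of [Y], the outer one sends that range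
   into [X]. *)
have := @subtensor_increasing X _ (index_sets_gt0 B)
  (fun l i => enum_val (enum_val i)).
move=> /(_ (fun l i j ltij => enum_val_ltn (enum_val_ltn ltij))).
congr subtensor; congr Tensor; apply/ffunP => i; rewrite !ffunE /=.
by congr (tentry X _); apply/ffunP => l; rewrite !ffunE.
Qed.

(** A 1 x ... x 1 subtensor serves: properness bounds its rank by 1, rank 0 makes it a zero tensor,
    and rank 1 equals its dimension. Hence the maximum in [rank_closure] is attained and is not the
    default 0 of an empty range. *)
Lemma full_rank_subtensor_exists r X : proper_rank r ->
  exists A : index_sets X, full_rank r (subtensor_of A).
Proof.
move=> [hr r_le].
have pt_neq0 l : [set Ordinal (dim_gt0 l)] != set0 :> {set 'I_(tdim X l)}.
  by rewrite -card_gt0 cards1.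
pose A : index_sets X :=
  [ffun l => exist (fun B : {set _} => B != set0) _ (pt_neq0 l)].
have cubA : cubical (subtensor_of A) 1 by move=> l; rewrite /= ffunE /= cards1.
exists A; apply/orP; have := r_le _ _ cubA; rewrite leq_eqVlt ltnS leqn0.
case/orP => [/eqP r1 | /eqP r0]; [right | left; exact/(rank_eq0 hr)].
by apply/existsP; exists (Ordinal (Defs.order_gt0 X)); rewrite r1 cubA.
Qed.

Lemma rank_closure_attained r X : proper_rank r ->
  exists Y, [/\ subtensor Y X, full_rank r Y & rank_closure r X = r Y].
Proof.
move=> /(full_rank_subtensor_exists X) [A0 fullA0].
have [|A fullA rA] := @eq_bigmax_cond _
    [pred A : index_sets X | full_rank r (subtensor_of A)]
    (fun A => r (subtensor_of A)).
  by apply/card_gt0P; exists A0.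
by exists (subtensor_of A); split => //; exists A.
Qed.

Lemma leq_rank_closure r X Y :
  subtensor Y X -> full_rank r Y -> r Y <= rank_closure r X.
Proof.
move=> [A ->] fullA.
exact: (@leq_bigmax_cond _ _ (fun A => r (subtensor_of A))).
Qed.

Lemma rank_closure_leq r X : tensor_rank_function r -> rank_closure r X <= r X.
Proof.
by move=> hr; apply/bigmax_leqP => A _; apply: (rank_subtensor hr); exists A.
Qed.

Lemma rank_closure_subtensor r X Y : proper_rank r ->
  subtensor Y X -> rank_closure r Y <= rank_closure r X.
Proof.
move=> hr sYX; have [Z [sZY fullZ ->]] := rank_closure_attained Y hr.
exact: leq_rank_closure (subtensor_trans sZY sYX) fullZ.
Qed.

Lemma rank_closure_full_rank r X : tensor_rank_function r ->
  full_rank r X -> rank_closure r X = r X.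
Proof.
move=> hr fullX; apply/eqP.
by rewrite eqn_leq rank_closure_leq // leq_rank_closure //; apply: subtensor_refl.
Qed.

End Subtensors.

Theorem theorem5p3 (R : realType) (r : tensor R -> nat) (hr : proper_rank r) :
  max_full_rank_subtensor_property (rank_closure r).
Proof.
move=> X; have [Y [sYX fullY rXY]] := rank_closure_attained X hr.
have rY := rank_closure_full_rank hr.1 fullY.
exists Y; last by rewrite rXY rY.
(* [full_rank] depends on the rank function only through its value at [Y], where [r] and its closure
   agree. *)
split=> //; first by rewrite /full_rank rY.
by move=> Z sZX _; rewrite rY -rXY; apply: rank_closure_subtensor.
Qed.
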